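(* Let $\Bbbk \subset \mathbb{R}$ be a subring, let $(W,S)$ be a Coxeter system, and let $V$ be a realization of $(W,S)$ over $\Bbbk$ which preserves a full $\mathbb{Z}$-lattice $\Lambda \subset V$ and preserves an orthant inside $\Lambda$. Then $W$ permutes a $\mathbb{Z}$-basis of $\Lambda$, and each simple reflection $s \in S$ acts on this basis either trivially or as a transposition.
   Context: Realization: Let $\Bbbk$ be a commutative domain, $V$ a free $\Bbbk$-module, $V^* = \operatorname{Hom}_{\Bbbk}(V,\Bbbk)$, and $(W,S)$ a Coxeter system, with $m_{st}$ the order of $st$ in $W$. A realization of $(W,S)$ over $\Bbbk$ is the data of $V$ and, for each $s \in S$, of a simple root $\alpha_s \in V$ and a simple coroot $\alpha_s^\vee \in V^*$ such that (1) $\alpha_s^\vee(\alpha_s) = 2$; (2) for $s \neq t$, $\alpha_s^\vee(\alpha_t) = 0$ if and only if $m_{st} = 2$; (3) the assignment $s(v) := v - \alpha_s^\vee(v)\,\alpha_s$ defines a $\Bbbk$-linear action of $W$ on $V$. Preserving a full $\mathbb{Z}$-lattice $\Lambda$ means: $\Lambda$ is the $\mathbb{Z}$-span of some $\Bbbk$-basis of $V$ and $\Lambda$ is preserved by the action of $W$ (roots need not lie in $\Lambda$). An orthant in the free $\mathbb{Z}$-module $\Lambda$ is the $\mathbb{Z}_{\ge 0}$-span of a $\mathbb{Z}$-basis of $\Lambda$; it is preserved if $W$ maps it to itself. *)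

(* Defs.v *)
From HB Require Import structures.
From mathcomp Require Import all_boot all_order all_algebra.
From mathcomp Require Import boolp classical_sets functions reals.

Set Implicit Arguments.
Unset Strict Implicit.
Unset Printing Implicit Defensive.

Import Order.TTheory GRing.Theory Num.Theory.

Local Open Scope classical_set_scope.
Local Open Scope ring_scope.

(** * Coxeter systems *)

(* [has_order x n] with [n : nat] forces [x] to have finite order. *)
Definition has_order (W : groupType) (x : W) (n : nat) : Prop :=
  [/\ (0 < n)%N, (x ^+ n = 1)%g
    & forall m : nat, (0 < m < n)%N -> (x ^+ m <> 1)%g].

Definition generates (W : groupType) (S : set W) : Prop :=
  forall H : set W, S `<=` H -> H 1%g ->
    (forall x y : W, H x -> H y -> H (x * y)%g) ->
    (forall x : W, H x -> H (x^-1)%g) ->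
  H = setT.

(* [W] is presented by the generators [S] and the relations (s t)^(m_st) = 1
   for those [s], [t] in [S] with m_st finite; the case [s = t], where
   m_ss = 1, gives s^2 = 1.  The last clause is the universal property of this
   presentation; uniqueness of the extension follows from generation. *)
Definition coxeter_system (W : groupType) (S : set W) : Prop :=
  [/\ forall s : W, S s -> has_order s 2,
      generates S
    & forall (G : groupType) (f : W -> G),
        (forall (s t : W) (n : nat), S s -> S t -> has_order (s * t)%g n ->
          ((f s * f t) ^+ n = 1)%g) ->
        exists phi : {multiplicative W -> G}, forall s : W, S s -> phi s = f s].

(** * Bases of modules of arbitrary rank *)

(* Finite linear combinations of elements of [B] with coefficients in [A]. *)
Definition span_with (R : pzRingType) (M : lmodType R) (A : set R) (B : set M) :
    set M :=
  [set v | exists (r : seq M) (c : M -> R),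
    [/\ forall x, x \in r -> B x, forall x, x \in r -> A (c x)
      & v = \sum_(x <- r) c x *: x]].

Definition lin_indep (R : pzRingType) (M : lmodType R) (B : set M) : Prop :=
  forall (r : seq M) (c : M -> R), uniq r -> (forall x, x \in r -> B x) ->
    \sum_(x <- r) c x *: x = 0 -> forall x, x \in r -> c x = 0.

(* [B] is an [R]-basis of the submodule [L] of [M]. *)
Definition basis_for (R : pzRingType) (M : lmodType R) (L B : set M) : Prop :=
  lin_indep B /\ span_with setT B = L.

(** * Realizations *)

(* In a realization [k] is an integral domain: below, a subring of the reals. *)
Record realization (k : comNzRingType) (V : lmodType k)
    (W : groupType) (S : set W) := Realization {
  simple_root : S -> V;
  simple_coroot : S -> {scalar V};
  act : W -> {linear V -> V};
  realization_free : exists B : set V, basis_for [set: V] B;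
  coroot_root : forall s : S, simple_coroot s (simple_root s) = 2;
  coroot_eq0 : forall s t : S, s <> t ->
        simple_coroot s (simple_root t) = 0 <-> has_order (\val s * \val t)%g 2;
  act1 : forall v : V, act 1%g v = v;
  actM : forall (x y : W) (v : V), act (x * y)%g v = act x (act y v);
  (* when [S] generates [W], [act] is determined by this formula *)
  act_simple : forall (s : S) (v : V), act (\val s) v = v - simple_coroot s v *: simple_root s
}.

(** * Lattices and orthants *)

Section Lattices.
Variables (k : comNzRingType) (V : lmodType k).
Implicit Types L O B : set V.

(* [zmodule V] is [V] with its canonical structure of module over [int]. *)
Definition z_basis_for L B : Prop := @basis_for int (zmodule V) L B.

Definition full_lattice L : Prop :=
  exists2 B, basis_for [set: V] B & L = @span_with int (zmodule V) setT B.

Definition orthant_of L O : Prop :=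
  exists2 B, z_basis_for L B
    & O = @span_with int (zmodule V) [set n : int | 0 <= n] B.

Definition preserves (W : groupType) (S : set W) (rho : realization V S)
    (X : set V) : Prop :=
  forall (w : W) (v : V), X v -> X (act rho w v).

Definition acts_trivially_on (f : V -> V) B : Prop :=
  forall b, B b -> f b = b.

Definition acts_as_transposition_on (f : V -> V) B : Prop :=
  exists x y : V, [/\ B x, B y & x <> y] /\
    [/\ f x = y, f y = x & forall b, B b -> b <> x -> b <> y -> f b = b].

End Lattices.

(* Main.v *)
(** The elements of the basis spanning an orthant are exactly its atoms, the
    nonzero elements which are not a sum of two nonzero elements of the orthant.
    Every [w] in [W] preserves the orthant, as does its inverse, so [w] permutes
    the atoms.  If a simple reflection [s] moves two elements [b] and [c] of the
    basis, then [s b - b] and [s c - c] are both multiples of the simple root,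
    hence proportional over the base ring; as they lie in a full lattice, they
    are then proportional over the integers, which contradicts the independence
    of the basis unless [c] is [b] or [s b]. *)
Require Import Defs.
From HB Require Import structures.
From mathcomp Require Import all_boot all_order all_algebra.
From mathcomp Require Import boolp classical_sets functions reals.
From mathcomp Require Import zify.

Set Implicit Arguments.
Unset Strict Implicit.
Unset Printing Implicit Defensive.

Import Order.TTheory GRing.Theory Num.Theory.

Local Open Scope classical_set_scope.
Local Open Scope ring_scope.

(** * Atoms of an orthant, and finite expansions over a basis *)

(** Only addition enters, and no basis, so an additive bijection matching two sets also matches
    their atoms. *)
Definition atom (M : zmodType) (O : set M) : set M :=
  [set x | [/\ O x, x <> 0
    & forall y z, O y -> O z -> x = y + z -> y = 0 \/ z = 0]].

Lemma atom_stable (M N : zmodType) (f : {additive M -> N}) (g : {additive N -> M})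
    (O : set M) (O' : set N) :
  cancel f g -> cancel g f ->
  (forall x, O x -> O' (f x)) -> (forall y, O' y -> O (g y)) ->
  forall x, atom O x -> atom O' (f x).
Proof.
move=> fK gK fO gO x [Ox x0 xat]; split; first exact: fO.
  by move=> fx0; apply: x0; rewrite -(fK x) fx0 raddf0.
move=> y z Oy Oz fxE.
have [|||E|E] := xat (g y) (g z); try exact: gO.
- by rewrite -raddfD -fxE fK.
- by left; rewrite -(gK y) E raddf0.
- by right; rewrite -(gK z) E raddf0.
Qed.

(* In [span_with] the sequence may have repetitions. *)
Lemma span_with_uniq (R : pzRingType) (M : lmodType R) (A : set R) (B : set M) v :
  A 0 -> (forall a b, A a -> A b -> A (a + b)) -> span_with A B v ->
  exists (r : seq M) (c : M -> R),
    [/\ forall x, x \in r -> B x, forall x, A (c x)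
      & forall r', uniq r' -> {subset r <= r'} -> v = \sum_(x <- r') c x *: x].
Proof.
move=> A0 AD [r [c [rB cA ->]]].
(* Repetitions are absorbed into the coefficient, which thereby vanishes off [r]; enlarging the
   sequence then leaves the sum unchanged. *)
exists r, (fun x => c x *+ count_mem x r); split => [//|x|r' r'u rr'] /=.
  have [xr|/count_memPn ->] := boolP (x \in r); last by rewrite mulr0n.
  by elim: count => [|n IHn]; rewrite ?mulr0n// mulrS; apply: AD => //; exact: cA.
transitivity (\sum_(x <- undup r) (c x *+ count_mem x r) *: x).
  rewrite -big_undup_iterop_count /=.
  by apply: eq_bigr => x _; rewrite -scalerMnl.
rewrite [RHS](bigID (mem r)) /= [X in _ + X]big1 ?addr0; last first.
  by move=> x /count_memPn ->; rewrite mulr0n scale0r.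
rewrite -[RHS]big_filter.
apply: perm_big; apply: uniq_perm; rewrite ?undup_uniq ?filter_uniq//.
move=> x; rewrite mem_undup mem_filter.
by apply/idP/andP => [xr|[]//]; split=> //; exact: rr'.
Qed.

Lemma span_with_uniq2 (R : pzRingType) (M : lmodType R) (A : set R) (B : set M)
    v w :
  A 0 -> (forall a b, A a -> A b -> A (a + b)) ->
  span_with A B v -> span_with A B w ->
  exists (r : seq M) (c d : M -> R),
    [/\ uniq r, forall x, x \in r -> B x, forall x, A (c x) /\ A (d x),
        v = \sum_(x <- r) c x *: x & w = \sum_(x <- r) d x *: x].
Proof.
move=> A0 AD /(span_with_uniq A0 AD)[r [c [rB cA vE]]].
move=> /(span_with_uniq A0 AD)[r' [d [r'B dA wE]]].
exists (undup (r ++ r')), c, d; split => //; first exact: undup_uniq.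
- by move=> x; rewrite mem_undup mem_cat => /orP[/rB|/r'B].
- by apply: vE; rewrite ?undup_uniq// => x xr; rewrite mem_undup mem_cat xr.
- by apply: wE; rewrite ?undup_uniq// => x xr; rewrite mem_undup mem_cat xr orbT.
Qed.

Lemma mem_span_with (R : pzRingType) (M : lmodType R) (A : set R) (B : set M) b a :
  B b -> A a -> span_with A B (a *: b).
Proof.
move=> Bb Aa; exists [:: b], (fun=> a); split=> [x|//|]; last by rewrite big_seq1.
by rewrite inE => /eqP ->.
Qed.

Lemma lin_indep_neq0 (R : nzRingType) (M : lmodType R) (B : set M) b :
  lin_indep B -> B b -> b <> 0.
Proof.
move=> Bi Bb b0; have /eqP := oner_neq0 R; apply.
apply: (Bi [:: b] (fun=> 1)) (mem_head _ _) => //.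
- by move=> x; rewrite inE => /eqP ->.
- by rewrite big_seq1 b0 scaler0.
Qed.

(** An expansion of an atom reduces to a single term, whose coefficient must be 1. Conversely, if a
    basis element is [y + z], the nonnegative coordinates of [y] and [z] add up to 0 away from it
    and to 1 at it, so one summand has no nonzero coordinate. *)
Lemma atom_orthant (M : lmodType int) (B : set M) :
  lin_indep B -> atom (span_with [set n : int | 0 <= n] B) = B.
Proof.
move=> Bi; set A := [set n : int | 0 <= n].
have A0 : A 0 by [].
have AD a b : A a -> A b -> A (a + b) by exact: addr_ge0.
apply/seteqP; split=> x.
- case=> -[r [c []]]; elim: r => [|b r IHr] rB cA xE x0 xat.
    by case: x0; rewrite xE big_nil.
  have rB' y : y \in r -> B y by move=> yr; apply: rB; rewrite inE yr orbT.
  have cA' y : y \in r -> A (c y) by move=> yr; apply: cA; rewrite inE yr orbT.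
  have Bb : B b by apply: rB; exact: mem_head.
  have Acb : A (c b) by apply: cA; exact: mem_head.
  rewrite big_cons in xE.
  have [||E|E] := xat _ _ _ _ xE.
  + exact: mem_span_with.
  + by exists r, c.
  + by rewrite E add0r in xE; exact: IHr.
  rewrite E addr0 in xE.
  have cb_neq0 : c b <> 0 by move=> cb0; apply: x0; rewrite xE cb0 scale0r.
  (* Splitting off one copy of [b] stays inside the orthant because the nonzero coefficient [c b] is
     at least 1. *)
  have xE' : x = 1 *: b + (c b - 1) *: b by rewrite -scalerDl addrC subrK.
  have [|||E'] := xat _ _ _ _ xE'.
  + exact: mem_span_with.
  + apply: mem_span_with => //; move: Acb cb_neq0; rewrite /A /=; lia.
  + by rewrite scale1r => b0; case: (lin_indep_neq0 Bi Bb).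
  + by rewrite xE' E' addr0 scale1r.
- move=> Bx; split.
  + by rewrite -[x]scale1r; exact: mem_span_with.
  + exact: lin_indep_neq0 Bx.
  move=> y z Oy Oz xE.
  have [r [c [d [ru rB cdA yE zE]]]] := span_with_uniq2 A0 AD Oy Oz.
  (* [x] need not occur in [r], so independence is applied on [r']; the factor [(v \in r)%:R] below
     discards the values of [c] and [d] outside [r]. *)
  pose r' := undup (x :: r).
  have coef_sum u : u \in r -> c u + d u = (u == x)%:R.
    move=> ur; have ur' : u \in r' by rewrite mem_undup inE ur orbT.
    have := Bi r' (fun v => (v \in r)%:R * (c v + d v) - (v == x)%:R).
    move/(_ (undup_uniq _)) => /(_ _ _ _ ur'); rewrite ur mul1r => H.
    apply/eqP; rewrite -subr_eq0; apply/eqP; apply: H.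
      by move=> v; rewrite mem_undup inE => /orP[/eqP ->//|/rB].
    under eq_bigr do rewrite scalerBl.
    rewrite sumrB; apply/eqP; rewrite subr_eq0; apply/eqP.
    rewrite [RHS](bigD1_seq x) ?undup_uniq ?mem_undup ?mem_head//= eqxx scale1r.
    rewrite [X in _ = _ + X]big1 ?addr0; last first.
      by move=> v /negPf ->; rewrite scale0r.
    rewrite xE yE zE -big_split /= (bigID (mem r)) /= [X in _ + X]big1 ?addr0.
      rewrite -big_filter; transitivity (\sum_(v <- r) (c v + d v) *: v).
        rewrite (perm_big r).
          by apply: eq_big_seq => v ->; rewrite mul1r.
        apply: uniq_perm; rewrite ?filter_uniq ?undup_uniq// => v.
        by rewrite mem_filter mem_undup inE; case: (v \in r); rewrite ?orbT.
      by apply: eq_bigr => v _; rewrite scalerDl.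
    by move=> v /negPf ->; rewrite mul0r scale0r.
  have [cx0|cx0] := eqVneq (c x) 0; [left|right].
  + rewrite yE big_seq big1// => u ur.
    have [->|ux] := eqVneq u x; first by rewrite cx0 scale0r.
    have [cu du] := cdA u; have := coef_sum u ur; rewrite (negPf ux) => cd0.
    suff -> : c u = 0 by rewrite scale0r.
    by move: cu du cd0; rewrite /A /=; lia.
  + rewrite zE big_seq big1// => u ur.
    have [cu du] := cdA u; have := coef_sum u ur => cd0.
    suff -> : d u = 0 by rewrite scale0r.
    move: cd0 cu du; rewrite /A /=; have [->|_] := eqVneq u x; last by lia.
    by move: cx0 => /eqP; lia.
Qed.

(** * Integral proportionality in a full lattice *)

(** The lattice is spanned by a basis over [k], so a relation over [k] holds coordinatewise between
    integers; cross multiplying two coordinates and cancelling [a] leaves an identity in the image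
    of the integers. *)
Lemma full_lattice_proportional (k : comNzRingType) (V : lmodType k) (L : set V)
    (x y : V) (a b : k) :
  (forall c d : k, c * d = 0 -> c = 0 \/ d = 0) ->
  (forall m : int, m%:~R = 0 :> k -> m = 0) ->
  full_lattice L -> L x -> L y -> x <> 0 -> a <> 0 -> a *: x = b *: y ->
  exists m n : int, m <> 0 /\ y *~ m = x *~ n.
Proof.
move=> kdom kchar [B [Bi _] ->] Lx Ly x0 a0 abE.
have [r [c [d [ru rB _ xE yE]]]] :=
  @span_with_uniq2 int (zmodule V) setT B x y I (fun _ _ _ _ => I) Lx Ly.
(* Integer combinations are rewritten over [k], where the independence of [B] is known. *)
have scaleE (e : V -> int) : \sum_(z <- r) (e z *: (z : zmodule V))
    = \sum_(z <- r) (e z)%:~R *: (z : V).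
  by apply: eq_bigr => z _; rewrite scaler_int.
rewrite scaleE in xE; rewrite scaleE in yE.
have cdE z : z \in r -> a * (c z)%:~R = b * (d z)%:~R.
  move=> zr; apply/eqP; rewrite -subr_eq0; apply/eqP.
  apply: (Bi r (fun z => a * (c z)%:~R - b * (d z)%:~R)) zr => //.
  under eq_bigr do rewrite scalerBl -!scalerA.
  by rewrite sumrB -!scaler_sumr -xE -yE abE subrr.
have [z zr cz0] : exists2 z, z \in r & c z != 0.
  apply/hasP; apply/negP => /negP/hasPn rc0; apply: x0.
  rewrite xE big_seq big1// => z /rc0; rewrite negbK => /eqP ->.
  by rewrite mulr0z scale0r.
(* The multipliers are the coordinates of [x] and [y] at a place [z] where [x] does not vanish. *)
exists (c z), (d z); split; first exact/eqP.
rewrite -!scaler_int {1}yE {1}xE !scaler_sumr; apply: eq_big_seq => u ur.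
rewrite !scalerA -!intrM; congr (_%:~R *: _).
apply/eqP; rewrite -subr_eq0; apply/eqP/kchar.
have [] // := kdom a (c z * d u - d z * c u)%:~R.
rewrite rmorphB !rmorphM /= mulrBr mulrA cdE//.
by rewrite mulrCA cdE// mulrCA mulrA subrr.
Qed.

Lemma sub_ring_domain (R : realType) (K : pred R)
    (k : GRing.SubComNzRing.type K) (c d : k) :
  c * d = 0 -> c = 0 \/ d = 0.
Proof.
move=> /(congr1 val); rewrite rmorphM rmorph0 => /eqP; rewrite mulf_eq0.
by case/orP => /eqP E; [left|right]; apply: val_inj; rewrite E rmorph0.
Qed.

Lemma sub_ring_char0 (R : realType) (K : pred R)
    (k : GRing.SubComNzRing.type K) (m : int) :
  m%:~R = 0 :> k -> m = 0.
Proof.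
by move=> /(congr1 val); rewrite rmorph_int rmorph0 => /eqP; rewrite intr_eq0 => /eqP.
Qed.

(** * The action on the module and its simple reflections *)

Section Action.
Variables (k : comNzRingType) (V : lmodType k) (W : groupType) (S : set W).
Variable rho : realization V S.

Lemma actK w : cancel (act rho w) (act rho w^-1%g).
Proof. by move=> v; rewrite -actM mulVg act1. Qed.

Lemma actVK w : cancel (act rho w^-1%g) (act rho w).
Proof. by move=> v; rewrite -actM mulgV act1. Qed.

Lemma preserves_bij (X : set V) :
  preserves rho X -> forall w, set_bij X X (act rho w).
Proof.
move=> rhoX w; split.
- by move=> v /(rhoX w).
- by move=> u v _ _; exact: (can_inj (actK w)).
- by move=> v Xv; exists (act rho w^-1%g v); [exact: rhoX|exact: actVK].
Qed.

Lemma preserves_atom (O : set V) : preserves rho O -> preserves rho (atom O).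
Proof.
move=> rhoO w v; apply: atom_stable (actK w) (actVK w) _ _ _ => u; exact: rhoO.
Qed.

(** Both displacements are multiples of the simple root. It may lie outside the lattice, and the
    crossed coefficients eliminate it without division. *)
Lemma simple_move_proportional (s : S) (u v : V) :
  simple_coroot rho s v *: (act rho (\val s) u - u)
  = simple_coroot rho s u *: (act rho (\val s) v - v).
Proof.
by rewrite !act_simple ![_ - _ *: _ - _]addrAC !subrr !sub0r !scalerN !scalerA mulrC.
Qed.

End Action.

(** * The permuted basis *)

Theorem corollary2p2 (R : realType) (K : pred R) (k : GRing.SubComNzRing.type K)
    (W : groupType) (S : set W) (V : lmodType k) (rho : realization V S)
    (L O : set V) :
  coxeter_system S ->
  full_lattice L -> preserves rho L ->
  orthant_of L O -> preserves rho O ->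
  exists2 B : set V, z_basis_for L B &
    (forall w : W, set_bij B B (act rho w)) /\
    (forall s : S, acts_trivially_on (act rho (\val s)) B
                   \/ acts_as_transposition_on (act rho (\val s)) B).
Proof.
move=> [Sinv _ _] Lfull _ [B LB OE] rhoO; exists B => //.
have [Bi BL] := LB.
have rhoB : preserves rho B.
  have <- : atom O = B by rewrite OE; exact: (@atom_orthant (zmodule V)).
  exact: preserves_atom.
split=> [|s]; first exact: preserves_bij.
set f := act rho (\val s).
have fB v : B v -> B (f v) by exact: rhoB.
have fK : cancel f f.
  move=> v; have [_ ss _] := Sinv (\val s) (set_valP s).
  by rewrite /f -actM -expg2 ss act1.
have [triv|/existsNP[b /not_implyP[Bb fb]]] := pselect (acts_trivially_on f B).
  by left.
right; exists b, (f b); split; first by split=> //; [exact: fB|exact: nesym].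
(* A further moved element [c] outside the pair [b], [f b] is assumed, towards a contradiction. *)
split=> // c Bc cb cfb; apply: contrapT => fc.
have Lsub u v : B u -> B v -> u <> v -> L (u - v).
  move=> Bu Bv /eqP uv; rewrite -BL.
  exists [:: u; v], (fun z => if z == u then 1 else -1); split=> // [z|].
    by rewrite !inE => /orP[] /eqP ->.
  by rewrite big_cons big_seq1 eqxx [v == u]eq_sym (negPf uv) scale1r scaleN1r.
(* This value is the factor of [f b - b] in the proportionality, and it has to be cancelled. *)
have coroot_c : simple_coroot rho s c <> 0.
  by move=> c0; apply: fc; rewrite /f act_simple c0 scale0r subr0.
have [m [n [m0 mnE]]] : exists m n : int, m <> 0 /\ (f c - c) *~ m = (f b - b) *~ n.
  apply: full_lattice_proportional Lfull _ _ _ coroot_c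
    (simple_move_proportional rho s b c).
  - exact: sub_ring_domain.
  - exact: sub_ring_char0.
  - exact: Lsub (fB _ Bb) Bb fb.
  - exact: Lsub (fB _ Bc) Bc fc.
  - by move/eqP; rewrite subr_eq0 => /eqP.
have ne (u v : V) : u <> v -> (u == v) = false by move/eqP/negPf.
have fcb : f c <> b by move=> E; apply: cfb; rewrite -E fK.
have fcfb : f c <> f b by move=> /(can_inj fK).
(* Coefficients of the relation between [c], [f c], [b] and [f b] given by [mnE]. These four are
   distinct, and among them the final default is reached only at [f b]. *)
pose e z : int := if z == c then - m else if z == f c then m
                  else if z == b then n else - n.
have eE : (e c = - m) * (e (f c) = m) * (e b = n) * (e (f b) = - n).
  rewrite /e !eqxx (ne _ _ fc) (ne _ _ (nesym cb)) (ne _ _ (nesym fcb)).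
  by rewrite (ne _ _ (nesym cfb)) (ne _ _ (nesym fcfb)) (ne _ _ fb).
apply: m0; suff : e c = 0 by rewrite eE => /eqP; rewrite oppr_eq0 => /eqP.
apply: (Bi [:: c; f c; b; f b] e); last exact: mem_head.
- rewrite /= !inE (ne _ _ (nesym fc)) (ne _ _ cb) (ne _ _ cfb) (ne _ _ fcb).
  by rewrite (ne _ _ fcfb) (ne _ _ (nesym fb)).
- by move=> z; rewrite !inE => /or4P[] /eqP -> //; exact: fB.
- rewrite !big_cons big_nil !eE addr0 /=.
  change (c *~ - m + (f c *~ m + (b *~ n + f b *~ - n)) = 0 :> V).
  have := mnE; rewrite !mulrzBl => fcE.
  by rewrite addrA !mulrNz [- (c *~ m) + _]addrC fcE addrA subrK subrr.
Qed.
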